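(* Let $t\ge 1$ and let $H_1, H_2, \dots, H_t$ be $4$-uniform hypergraphs with orders greater than $4$ such that each $H_i$ is isomorphic to either a complete $4$-uniform hypergraph or a complete $4$-uniform hypergraph with a single hyperedge removed. Then $$gr(H_1, H_2, \dots, H_t, K_5^{(4)}, K_5^{(4)};4)\ge \left(gr(H_1, H_2, \dots, H_t;4)-1\right)^2+1.$$
   Context: An $r$-uniform hypergraph $H=(V,E)$ consists of a nonempty finite set $V$ of vertices and a set $E$ of hyperedges, which are (distinct) $r$-element subsets of $V$; its order is $|V|$. $K_n^{(r)}$ denotes the complete $r$-uniform hypergraph of order $n$ (every $r$-element subset of the vertex set is a hyperedge). A $t$-coloring of an $r$-uniform hypergraph $H$ is a function $E(H)\to\{1,2,\dots,t\}$. A hypergraph is rainbow under a coloring if all of its hyperedges receive pairwise distinct colors. A Gallai $t$-coloring of $K_n^{(r)}$ is a $t$-coloring that contains no rainbow subhypergraph isomorphic to $K_{r+1}^{(r)}$. For $r$-uniform hypergraphs $H_1,\dots,H_t$, the Gallai-Ramsey number $gr(H_1,\dots,H_t;r)$ is the least natural number $p$ such that every Gallai $t$-coloring of $K_p^{(r)}$ contains, for some $i\in\{1,\dots,t\}$, a (not necessarily induced) subhypergraph isomorphic to $H_i$ all of whose hyperedges have color $i$. Here the number on the left-hand side of the claim involves $t+2$ colors and the one on the right-hand side involves $t$ colors. *)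

(* Defs.v *)
From HB Require Import structures.
From mathcomp Require Import all_boot.

Set Implicit Arguments.
Unset Strict Implicit.
Unset Printing Implicit Defensive.

(* Nonemptiness of the vertex set is not a field, so that [complete r 0] makes
   sense; results about hypergraphs that must be nonempty bound their [horder]
   from below. *)
Record hypergraph (r : nat) := Hypergraph {
  vertex :> finType;
  edges : {set {set vertex}};
  edges_uniform : forall e, e \in edges -> #|e| = r
}.

Definition horder r (H : hypergraph r) : nat := #|vertex H|.

Definition complete_edges (r n : nat) : {set {set 'I_n}} :=
  [set e : {set 'I_n} | #|e| == r].

Lemma complete_uniform r n (e : {set 'I_n}) :
  e \in complete_edges r n -> #|e| = r.
Proof. by rewrite inE => /eqP. Qed.

Definition complete r n : hypergraph r :=
  Hypergraph (@complete_uniform r n).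

Lemma del_edge_uniform r (H : hypergraph r) (e0 e : {set H}) :
  e \in edges H :\ e0 -> #|e| = r.
Proof. by rewrite in_setD1 => /andP[_ /edges_uniform]. Qed.

Definition del_edge r (H : hypergraph r) (e0 : {set H}) : hypergraph r :=
  Hypergraph (@del_edge_uniform r H e0).

Definition image_edges r (G : hypergraph r) (V : finType) (f : G -> V) :
  {set {set V}} := [set f @: e | e : {set G} in edges G].

Definition isomorphic r (G H : hypergraph r) : Prop :=
  exists2 f : G -> H, bijective f & edges H = image_edges f.

Definition is_complete r (H : hypergraph r) : Prop :=
  exists n, isomorphic H (complete r n).

Definition is_complete_minus_edge r (H : hypergraph r) : Prop :=
  exists n, exists2 e : {set complete r n},
    e \in edges (complete r n) & isomorphic H (del_edge e).

(* [F] is the edge set of a (not necessarily induced) subhypergraph of [H]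
   isomorphic to [G]; its vertex set is the image of [f]. *)
Definition copy_edges r (G H : hypergraph r) (F : {set {set H}}) : bool :=
  [exists f : {ffun G -> H},
    [&& injectiveb f, F == image_edges f & F \subset edges H]].

Definition coloring r (H : hypergraph r) (t : nat) :=
  {ffun {e : {set H} | e \in edges H} -> 'I_t}.

Definition rainbow r t (H : hypergraph r) (c : coloring H t)
    (F : {set {set H}}) : bool :=
  [forall e1, forall e2,
    [&& val e1 \in F, val e2 \in F & c e1 == c e2] ==> (e1 == e2)].

Definition monochromatic r t (H : hypergraph r) (c : coloring H t)
    (i : 'I_t) (F : {set {set H}}) : bool :=
  [forall e, (val e \in F) ==> (c e == i)].

Definition gallai r t (H : hypergraph r) (c : coloring H t) : bool :=
  ~~ [exists F, copy_edges (complete r r.+1) F && rainbow c F].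

Definition has_mono_copy r t (H : hypergraph r) (c : coloring H t)
    (i : 'I_t) (G : hypergraph r) : bool :=
  [exists F, copy_edges G F && monochromatic c i F].

Definition gallai_arrow r t (Hs : 'I_t -> hypergraph r) (p : nat) : bool :=
  [forall c : coloring (complete r p) t,
    gallai c ==> [exists i, has_mono_copy c i (Hs i)]].

(* Ramsey's theorem for uniform hypergraphs, which makes [gr] below a
   genuine minimum. *)
Lemma ramsey r t N : exists n, forall (V : finType) (S : {set V})
    (c : {set V} -> 'I_t), n <= #|S| ->
  exists i, exists2 T : {set V}, T \subset S /\ N <= #|T| &
    forall e : {set V}, e \subset T -> #|e| = r -> c e = i.
Proof.
elim: r N => [|r IHr] N.
  exists N => V S c leNS; exists (c set0), S => // e _ /eqP.
  by rewrite cards_eq0 => /eqP->.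
suff main (m : nat) (k : 'I_t -> nat) : \sum_i k i <= m -> exists n,
    forall (V : finType) (S : {set V}) (c : {set V} -> 'I_t), n <= #|S| ->
    exists i, exists2 T : {set V}, T \subset S /\ k i <= #|T| &
    forall e : {set V}, e \subset T -> #|e| = r.+1 -> c e = i.
  by have [n nP] := main _ (fun=> N) (leqnn _); exists n.
elim: m k => [|m IHm] k lekm; have [/existsP[i /eqP ki0]|k_gt0] :=
    boolP [exists i, k i == 0].
- exists 0 => V S c _; exists i, set0; rewrite ?sub0set ?ki0 // => e.
  by rewrite subset0 => /eqP->; rewrite cards0.
- exists 0 => V S c _; case/existsP: k_gt0; exists (c set0).
  by move: lekm; rewrite leqn0 sum_nat_eq0 => /forallP/(_ (c set0)).
- exists 0 => V S c _; exists i, set0; rewrite ?sub0set ?ki0 // => e.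
  by rewrite subset0 => /eqP->; rewrite cards0.
have {}k_gt0 i : 0 < k i.
  by rewrite lt0n; move: k_gt0; rewrite negb_exists => /forallP.
pose k' i j := if j == i then (k j).-1 else k j.
have sum_k' i : \sum_j k' i j <= m.
  rewrite -ltnS (leq_trans _ lekm) // (bigD1 i) //=.
  rewrite [X in _ < X](bigD1 i) //= /k' eqxx -addSn prednK ?k_gt0 //.
  by rewrite leq_add2l leq_sum // => j /negPf->.
have /fin_all_exists[n nP] := fun i => IHm (k' i) (sum_k' i).
have [M MP] := IHr (\max_i n i); exists M.+1 => V S c ltMS.
have /card_gt0P[x xS] : 0 < #|S| by apply: leq_trans ltMS.
have := MP V (S :\ x) (fun e => c (x |: e)).
rewrite (cardsD1 x S) xS ltnS in ltMS; case=> // i [T [sTS leT] cT].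
have [|j [U [sUT leU] cU]] := nP i V T c.
  exact: leq_trans (leq_bigmax i) leT.
have sUS : U \subset S :\ x := subset_trans sUT sTS.
exists j; move: leU; rewrite /k'; case: eqP => [eji|_] leU; last first.
  by exists U => //; split=> //; apply: subset_trans sUS (subsetDl _ _).
exists (x |: U).
  have xU : x \notin U.
    by apply/negP => /(subsetP sUS); rewrite !inE eqxx.
  rewrite cardsU1 xU add1n -(prednK (k_gt0 j)) ltnS leU; split=> //.
  by rewrite subUset sub1set xS (subset_trans sUS (subsetDl _ _)).
move=> e seU cde; have [xe|xe] := boolP (x \in e); last first.
  apply: cU => //; apply/subsetP=> y ye.
  have := subsetP seU y ye; rewrite in_setU1; case: eqP => // yx.
  by rewrite -yx ye in xe.
rewrite -(setD1K xe) eji; apply: cT.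
  by apply: subset_trans sUT; rewrite subDset.
by move: cde; rewrite (cardsD1 x e) xe => -[].
Qed.

Lemma gr_exists r t (Hs : 'I_t -> hypergraph r) : exists p, gallai_arrow Hs p.
Proof.
pose N := \max_i horder (Hs i).
have [n nP] := ramsey r t N; exists (maxn r n).
apply/forallP=> c; apply/implyP=> _; set p := maxn r n in c *.
have [e0 e0K] : exists e, e \in edges (complete r p).
  exists [set widen_ord (leq_maxl r n) i | i in 'I_r].
  rewrite inE card_imset ?card_ord //.
  by move=> i j [] /val_inj.
pose c' (e : {set 'I_p}) := c (insubd (exist _ e0 e0K) e).
have [|i [T [_ leT] cT]] := nP 'I_p setT c'.
  by rewrite cardsT card_ord leq_maxr.
apply/existsP; exists i.
have leHT : #|vertex (Hs i)| <= #|T|.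
  by apply: leq_trans leT; apply: (leq_bigmax i).
pose f : {ffun Hs i -> 'I_p} :=
  [ffun x => enum_val (widen_ord leHT (enum_rank x))].
have f_inj : injective f.
  move=> x y; rewrite !ffunE => /enum_val_inj/(congr1 val)/= /val_inj.
  exact: enum_rank_inj.
apply/existsP; exists (image_edges f); apply/andP; split.
  apply/existsP; exists f; rewrite eqxx /=; apply/andP; split; first exact/injectiveP.
  apply/subsetP=> _ /imsetP[e eE ->].
  by rewrite inE card_imset // (edges_uniform eE).
apply/forallP=> e; apply/implyP=> /imsetP[e' e'E def_e].
have := cT (val e); rewrite /c' valKd => ->//; last exact: edges_uniform (valP e).
rewrite def_e; apply/subsetP=> _ /imsetP[x _ ->]; rewrite ffunE.
exact: enum_valP.
Qed.

Definition gr r t (Hs : 'I_t -> hypergraph r) : nat :=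
  ex_minn (gr_exists Hs).

Definition cat_family T m n (x : 'I_m -> T) (y : 'I_n -> T)
    (i : 'I_(m + n)) : T :=
  match split i with inl j => x j | inr k => y k end.

(* Main.v *)
Require Import Defs.
From mathcomp Require Import all_boot zify.

(** A product construction gives the bound.  With n one less than the
    Gallai-Ramsey number of the family [Hs], fix a Gallai coloring k of the
    4-subsets of an n-set without a copy of any [Hs i] in color i, and let A and
    B be the two extra colors.  Vertices of the new complete hypergraph are
    (at most n ^ 2) pairs; the pairs with a given first coordinate form a block.
    A 4-set is colored according to how the blocks cut it:
    - 4 (inside one block): k of the second coordinates;
    - 1+1+1+1 (transversal): k of the first coordinates;
    - 3+1: color A;
    - 2+1+1: color B;
    - 2+2: a fixed old color [i0].

    A 5-set inside one block, or transversal, is colored as a 5-set of k.  Any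
    other 5-set is mixed, and deleting its vertices one at a time gives 4-sets of
    the following types:
<<
      4+1        one 4,       four 3+1
      3+2        two 3+1,     three 2+2
      3+1+1      two 3+1,     three 2+1+1
      2+2+1      one 2+2,     four 2+1+1
      2+1+1+1    two 1+1+1+1, three 2+1+1
>>
    In each row A or B is repeated, neither A nor B fills the row, and at
    most three entries have an old color ([product_coloring_cases]).  So the
    coloring is Gallai ([product_coloring_repeats]) and neither A nor B contains
    a complete hypergraph of order 5 ([product_coloring_no_K5]).  Since each
    [Hs i] lacks at most one edge, at least four of the five 4-subsets of any
    five of its vertices are edges, so a copy in an old color contains no mixed
    5-set.  As it has at least five vertices, such a copy is transversal or lies
    in one block, and projects to a copy for k ([product_coloring_copy]).

    The type of a 4-set e is read off the number of ordered pairs of elements of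
    e in a common block, [block_pairs]: 16, 10, 8, 6 and 4 for 4, 3+1, 2+2, 2+1+1
    and 1+1+1+1.  This number changes by 2 d - 1 when a vertex whose block meets
    the set in d points is deleted, which turns the table above into
    arithmetic ([five_set_cases]). *)

Set Implicit Arguments.
Unset Strict Implicit.
Unset Printing Implicit Defensive.

(** * Copies and rainbow cliques in terms of total colorings *)

Lemma card_predD1 (V : finType) (S e : {set V}) :
  e \subset S -> #|S| = #|e|.+1 -> exists2 v, v \in S & e = S :\ v.
Proof.
move=> sub_eS cardS.
have /cards1P[v Sv] : #|S :\: e| == 1.
  by rewrite cardsD (setIidPr sub_eS) cardS subSn // subnn.
exists v; first by have := set11 v; rewrite -Sv => /setDP[].
by rewrite -Sv setDDr setDv set0U (setIidPr sub_eS).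
Qed.

Lemma imset_setD1 (V W : finType) (g : V -> W) (S : {set V}) v :
  {in S &, injective g} -> v \in S -> g @: (S :\ v) = g @: S :\ g v.
Proof.
move=> g_inj vS; apply/setP=> y; rewrite in_setD1.
apply/imsetP/andP => [[x /setD1P[xv xS] ->]|[yv /imsetP[x xS y_x]]].
  by rewrite imset_f // (inj_in_eq g_inj).
exists x => //; rewrite in_setD1 xS andbT.
by apply: contraNneq yv => <-; rewrite y_x.
Qed.

(** Colorings are defined on the subtype of edges.  Here they are replaced by
    functions on all sets, which can be composed with images and deletions
    without carrying proofs that the result is an edge. *)
Section Extension.

Variables (r n t : nat) (c : coloring (complete r n) t) (k : {set 'I_n} -> 'I_t).
Hypothesis kE : forall e, c e = k (val e).

(** A copy of the complete hypergraph of order r + 1 is the set of all r-subsets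
    of an (r+1)-set S, and each of them is S minus a point. *)
Lemma gallaiP :
  reflect (forall S : {set 'I_n}, #|S| = r.+1 ->
             exists v w, [/\ v \in S, w \in S, v != w & k (S :\ v) = k (S :\ w)])
          (gallai c).
Proof.
apply: (iffP idP) => [/existsPn no_rainbow S cardS | repeated].
  pose f : {ffun complete r r.+1 -> complete r n} :=
    [ffun i => enum_val (cast_ord (esym cardS) i)].
  have f_inj : injective f.
    by move=> i j; rewrite !ffunE => /enum_val_inj/cast_ord_inj.
  have f_S i : f i \in S by rewrite ffunE enum_valP.
  have := no_rainbow (image_edges f); rewrite negb_and => /orP[/negP[]|].
    apply/existsP; exists f; rewrite eqxx /=; apply/andP; split.
      exact/injectiveP.
    apply/subsetP=> _ /imsetP[e eE ->].
    by rewrite inE card_imset // (edges_uniform eE).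
  have sub_edge e : e \in image_edges f -> exists2 v, v \in S & e = S :\ v.
    case/imsetP=> e' e'E ->; apply: card_predD1.
      by apply/subsetP=> _ /imsetP[i _ ->].
    by rewrite cardS card_imset // (edges_uniform e'E).
  case/forallPn=> e1 /forallPn[e2]; rewrite negb_imply.
  case/andP=> /and3P[/sub_edge[v vS e1E] /sub_edge[w wS e2E] /eqP].
  rewrite !kE e1E e2E => eq_k /eqP neq_e; exists v, w; split=> //.
  by apply/eqP=> vw; apply: neq_e; apply: val_inj; rewrite e1E e2E vw.
apply/existsPn=> F; apply/negP=> /andP[/existsP[f /and3P[/injectiveP f_inj]]].
move=> /eqP F_E /subsetP FE /forallP rb.
have [|v [w [/imsetP[i _ v_i] /imsetP[j _ w_j] vw eq_k]]] := repeated (f @: setT).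
  by rewrite card_imset // cardsT card_ord.
have f_del l : f @: setT :\ f l \in F.
  rewrite F_E -imset_setD1 ?inE //; last by move=> x y _ _; apply: f_inj.
  apply: imset_f; rewrite inE; have := cardsD1 l [set: 'I_r.+1].
  by rewrite cardsT card_ord in_setT add1n => -[/esym/eqP].
have := f_del i; have := f_del j; rewrite -v_i -w_j => wF vF.
pose E := fun e : {set complete r n} => e \in edges (complete r n).
have /forallP/(_ (exist E _ (FE _ wF))) := rb (exist E _ (FE _ vF)).
rewrite !kE /= vF wF eq_k eqxx /= => /eqP/(congr1 val)/= eqS.
have := setD11 v (f @: setT); rewrite eqS in_setD1 vw /= => /negP[].
by rewrite v_i imset_f.
Qed.

Lemma has_mono_copyP i (G : hypergraph r) :
  reflect (exists2 f : G -> 'I_n, injective f &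
             forall e : {set G}, e \in edges G -> k (f @: e) = i)
          (has_mono_copy c i G).
Proof.
apply: (iffP existsP) => [[F /andP[/existsP[f /and3P[/injectiveP f_inj]]]]|].
  move=> /eqP F_E /subsetP FE /forallP mono.
  exists f => // e eE.
  have eF : f @: e \in F by rewrite F_E imset_f.
  pose E := fun e : {set complete r n} => e \in edges (complete r n).
  by have := mono (exist E _ (FE _ eF)); rewrite kE /= eF => /eqP.
case=> f f_inj f_mono; exists (image_edges f); apply/andP; split.
  pose g : {ffun G -> complete r n} := [ffun x => f x]. apply/existsP; exists g.
  have gE (e : {set G}) : g @: e = f @: e by apply: eq_imset => x; rewrite ffunE.
  apply/and3P; split.
  - by apply/injectiveP=> x y; rewrite !ffunE; apply: f_inj.
  - by apply/eqP; apply: eq_imset => e; rewrite gE.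
  - apply/subsetP=> _ /imsetP[e eE ->].
    by rewrite inE card_imset // (edges_uniform eE).
apply/forallP=> e; apply/implyP=> /imsetP[e' e'E].
by rewrite kE => ->; rewrite f_mono.
Qed.

End Extension.

(** * How a partition into blocks cuts a set and its deletions *)

Section BlockPairs.

Variables (V B : finType) (a : V -> B).
Implicit Types (S e : {set V}) (u v : V).

Definition block_size S v := #|[set u in S | a u == a v]|.

Definition block_pairs S := \sum_(v in S) block_size S v.

Lemma block_size_gt0 S v : v \in S -> 0 < block_size S v.
Proof. by move=> vS; apply/card_gt0P; exists v; rewrite inE vS eqxx. Qed.

Lemma block_size_le S v : block_size S v <= #|S|.
Proof. by apply: subset_leq_card; apply/subsetP=> u; rewrite inE => /andP[]. Qed.

Lemma block_pairs_inj S : {in S &, injective a} -> block_pairs S = #|S|.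
Proof.
move=> a_inj; rewrite -sum1_card; apply: eq_bigr => v vS.
apply/eqP/cards1P; exists v; apply/setP=> u; rewrite !inE.
apply/andP/eqP => [[uS /eqP]|->]; [exact: a_inj | by rewrite eqxx].
Qed.

Lemma block_pairs_const S :
  {in S &, forall u v, a u = a v} -> block_pairs S = #|S| * #|S|.
Proof.
move=> a_const; rewrite -sum_nat_const; apply: eq_bigr => v vS.
apply: eq_card => u; rewrite inE; case uS: (u \in S) => //=.
by apply/eqP/a_const.
Qed.

(** Deleting v destroys the pairs (v, u) and (u, v) with u in the block of v;
    (v, v) is common to the two families. *)
Lemma block_pairsD1 S v :
  v \in S -> block_pairs (S :\ v) + (block_size S v).*2 = (block_pairs S).+1.
Proof.
move=> vS.
have sizeD1 u : block_size S u = (a v == a u) + block_size (S :\ v) u.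
  rewrite /block_size (cardsD1 v) !inE vS /=; congr (_ + _).
  by apply: eq_card => x; rewrite !inE andbA.
have -> : block_pairs S =
    block_size S v + (\sum_(u in S :\ v) (a v == a u) + block_pairs (S :\ v)).
  rewrite /block_pairs (big_setD1 v) //=; congr (_ + _).
  by rewrite -big_split /=; apply: eq_bigr => u _; apply: sizeD1.
have <- : (\sum_(u in S :\ v) (a v == a u)).+1 = block_size S v.
  rewrite sizeD1 eqxx add1n; congr _.+1.
  rewrite /block_size -sum1_card big_mkcond [RHS]big_mkcond /=.
  apply: eq_bigr => u _; rewrite !inE (eq_sym (a v)).
  by case: (u != v); case: (u \in S); case: (a u == a v).
lia.
Qed.

Definition block_size_class S j := [set v in S | block_size S v == j].

(** The class is a union of blocks of S, each with exactly j points. *)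
Lemma dvdn_block_size_class S j : j %| #|block_size_class S j|.
Proof.
rewrite -sum1_card (partition_big a predT) //=; apply: dvdn_sum => y _.
rewrite sum1dep_card.
have [v|A0] := pickP (mem [set v in block_size_class S j | a v == y]); last first.
  by rewrite (eq_card0 A0).
rewrite !inE => /andP[/andP[vS /eqP size_v] /eqP a_v].
suff -> : #|[set u in block_size_class S j | a u == y]| = block_size S v.
  by rewrite size_v.
apply: eq_card => u; rewrite !inE a_v.
case uS: (u \in S) => //=; case: (a u =P y) => [a_u|]; rewrite ?andbF //.
by rewrite -size_v /block_size a_u a_v eqxx.
Qed.

Definition deletions S m := [set v in S | block_pairs (S :\ v) == m].

Lemma deletions_block_size_class S j m :
  m + j.*2 = (block_pairs S).+1 -> deletions S m = block_size_class S j.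
Proof.
move=> mj; apply/setP=> v; rewrite !inE; case vS: (v \in S) => //=.
have := block_pairsD1 vS; rewrite -mj => eq_pairs; apply/eqP/eqP; lia.
Qed.

Lemma sum_block_size S (f : nat -> nat) :
  \sum_(v in S) f (block_size S v)
  = \sum_(j < #|S|.+1) #|block_size_class S j| * f j.
Proof.
rewrite (partition_big (fun v => inord (block_size S v) : 'I_#|S|.+1) predT) //=.
apply: eq_bigr => j _; rewrite -sum_nat_const; apply: congr_big => // v.
  rewrite inE; case vS: (v \in S) => //=.
  by rewrite -val_eqE /= inordK // ltnS block_size_le.
by case/andP=> _ /eqP <-; rewrite inordK // ltnS block_size_le.
Qed.

Lemma block_size_class0 S : block_size_class S 0 = set0.
Proof.
apply/setP=> v; rewrite !inE; apply/negP=> /andP[/block_size_gt0].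
by rewrite lt0n => /negPf->.
Qed.

Lemma block_size_class_full S j v :
  #|block_size_class S j| = #|S| -> v \in S -> block_size S v = j.
Proof.
move=> cardS vS; have /eqP classE : block_size_class S j == S.
  rewrite eqEcard cardS leqnn andbT.
  by apply/subsetP=> u; rewrite inE => /andP[].
by move: vS; rewrite -{1}classE inE => /andP[_ /eqP].
Qed.

Lemma block_size_class1_full S :
  #|block_size_class S 1| = #|S| -> {in S &, injective a}.
Proof.
move=> cardS u v uS vS a_uv.
have /eqP/cards1P[x xP] := block_size_class_full cardS vS.
have : u \in [set u in S | a u == a v] by rewrite inE uS a_uv eqxx.
have : v \in [set u in S | a u == a v] by rewrite inE vS eqxx.
by rewrite xP !inE => /eqP-> /eqP.
Qed.

Lemma block_size_class_card_full S :
  #|block_size_class S #|S| | = #|S| -> {in S &, forall u v, a u = a v}.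
Proof.
move=> cardS u v uS vS; have size_v := block_size_class_full cardS vS.
have /eqP blockE : [set u in S | a u == a v] == S.
  rewrite eqEcard -/(block_size S v) size_v leqnn andbT.
  by apply/subsetP=> x; rewrite inE => /andP[].
by move: uS; rewrite -blockE inE => /andP[_ /eqP].
Qed.

(** The table of the introductory comment, restricted to the columns 3+1 (10 block
    pairs) and 2+1+1 (6 block pairs).  Divisibility of the class of size j by j,
    together with their total 5, leaves only the integer partitions of 5. *)
Lemma five_set_cases S : #|S| = 5 ->
  [\/ {in S &, injective a}, {in S &, forall u v, a u = a v} |
    [/\ 2 <= #|deletions S 10| \/ 2 <= #|deletions S 6|,
        #|deletions S 10| <= 4 & #|deletions S 6| <= 4]].
Proof.
move=> card5; have := sum_block_size S id; have := sum_block_size S (fun=> 1).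
rewrite sum_nat_const card5 !big_ord_recr !big_ord0 /= block_size_class0 cards0.
rewrite -/(block_pairs S) => sum1 sumw.
have [n1|n1] := eqVneq #|block_size_class S 1| 5.
  by constructor 1; apply: block_size_class1_full; rewrite card5.
have [n5|n5] := eqVneq #|block_size_class S 5| 5.
  by constructor 2; apply: block_size_class_card_full; rewrite card5.
have delE j m : m + j.*2 = (block_pairs S).+1 ->
    #|deletions S m| = #|block_size_class S j|.
  by move=> mj; rewrite (deletions_block_size_class mj).
(* When the block size belonging to one column is not positive or exceeds 5,
   that column is bounded through the other one. *)
have disj : #|deletions S 10| + #|deletions S 6| <= 5.
  rewrite -cardsUI [X in _ + X]eq_card0 => [|v].
    rewrite addn0 -card5; apply: subset_leq_card.
    by apply/subsetP=> v; rewrite !inE => /orP[] /andP[].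
  by rewrite !inE; apply/negP=> /andP[/andP[_ /eqP ->] /andP[]].
have := delE 1 10; have := delE 2 10; have := delE 3 10; have := delE 4 10.
have := delE 1 6; have := delE 2 6; have := delE 3 6.
have := dvdn_block_size_class S 2; have := dvdn_block_size_class S 3.
have := dvdn_block_size_class S 4; have := dvdn_block_size_class S 5.
constructor 3; split; lia.
Qed.

End BlockPairs.

(** * Hypergraphs with at most one missing edge *)

Lemma superset_card (V : finType) (A : {set V}) m :
  #|A| <= m <= #|V| -> exists2 X : {set V}, A \subset X & #|X| = m.
Proof.
elim: m => [|m IHm] /andP[leAm lemV].
  by exists A => //; apply/eqP; rewrite -leqn0.
move: leAm; rewrite leq_eqVlt => /orP[/eqP cardA | ltAm]; first by exists A.
have [|X AX cardX] := IHm; first by rewrite -ltnS ltAm ltnW.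
have /card_gt0P[x] : 0 < #|~: X| by have := cardsC X; lia.
rewrite inE => xX; exists (x |: X); first exact: subset_trans AX (subsetU1 _ _).
by rewrite cardsU1 xX cardX.
Qed.

(** The common feature of complete hypergraphs and of those with one hyperedge
    removed; stated without a vertex count or an isomorphism. *)
Definition at_most_one_nonedge r (G : hypergraph r) :=
  forall e1 e2 : {set G}, #|e1| = r -> #|e2| = r ->
    e1 \notin edges G -> e2 \notin edges G -> e1 = e2.

Lemma isomorphic_mem_edges r (G H : hypergraph r) (f : G -> H) (e : {set G}) :
  injective f -> edges H = image_edges f -> (e \in edges G) = (f @: e \in edges H).
Proof. by move=> f_inj ->; rewrite mem_imset //; apply: imset_inj. Qed.

Lemma is_complete_nonedge r (G : hypergraph r) :
  is_complete G -> at_most_one_nonedge G.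
Proof.
case=> n [f /bij_inj f_inj edgesE] e1 e2 card1 _.
by rewrite (isomorphic_mem_edges _ f_inj edgesE) inE card_imset // card1 eqxx.
Qed.

Lemma is_complete_minus_edge_nonedge r (G : hypergraph r) :
  is_complete_minus_edge G -> at_most_one_nonedge G.
Proof.
case=> n [e0 _ [f /bij_inj f_inj edgesE]] e1 e2 card1 card2.
rewrite !(isomorphic_mem_edges _ f_inj edgesE) !inE !card_imset // card1 card2.
rewrite !eqxx !andbT !negbK => /eqP e1E /eqP e2E.
by apply: (imset_inj f_inj); rewrite e1E e2E.
Qed.

(** Distinct vertices of X have distinct deletions, so at most one deletion is the
    missing edge. *)
Lemma card_deletion_edges r (G : hypergraph r) (X : {set G}) :
  at_most_one_nonedge G -> #|X| = r.+1 ->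
  r <= #|[set v in X | X :\ v \in edges G]|.
Proof.
move=> nonedge cardX; set D := [set v in X | _].
have DX : D \subset X by apply/subsetP=> v; rewrite inE => /andP[].
have card_del v : v \in X -> #|X :\ v| = r.
  by move=> vX; move: cardX; rewrite (cardsD1 v) vX => -[].
suff : #|X :\: D| <= 1.
  by rewrite cardsD (setIidPr DX) cardX; have := subset_leq_card DX; lia.
apply/card_le1_eqP=> u v; rewrite !inE !negb_and => /andP[uD uX] /andP[vD vX].
move: uD vD; rewrite uX vX /= => uE vE.
have := nonedge _ _ (card_del u uX) (card_del v vX) uE vE.
by move/setP/(_ u); rewrite !inE eqxx uX /= andbT => /esym/negbFE/eqP.
Qed.

(** * The product coloring *)

Section ProductColoring.

Variables (V : finType) (n t : nat) (k : {set 'I_n} -> 'I_t) (i0 : 'I_t).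
Variables a b : V -> 'I_n.
Hypothesis ab_inj : forall u v, a u = a v -> b u = b v -> u = v.
Implicit Types S e : {set V}.

(** The block of a vertex is its first coordinate [a]; the values 10, 6, 16 and 4
    of [block_pairs] stand for the types 3+1, 2+1+1, 4 and 1+1+1+1, and [i0] is
    the color of the type 2+2. *)
Definition product_coloring e : 'I_(t + 2) :=
  if block_pairs a e == 10 then rshift t ord0
  else if block_pairs a e == 6 then rshift t ord_max
  else lshift 2 (if block_pairs a e == 16 then k (b @: e)
                 else if block_pairs a e == 4 then k (a @: e) else i0).

Lemma product_coloring_transversal e :
  #|e| = 4 -> {in e &, injective a} -> product_coloring e = lshift 2 (k (a @: e)).
Proof.
by move=> card4 a_inj; rewrite /product_coloring block_pairs_inj // card4.
Qed.

Lemma product_coloring_block e :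
  #|e| = 4 -> {in e &, forall u v, a u = a v} ->
  product_coloring e = lshift 2 (k (b @: e)).
Proof.
by move=> card4 a_const; rewrite /product_coloring block_pairs_const // card4.
Qed.

Lemma product_coloring_eq10 e :
  (product_coloring e == rshift t ord0) = (block_pairs a e == 10).
Proof.
rewrite /product_coloring; have [_|_] := ifP; first by rewrite eqxx.
by have [_|_] := ifP; rewrite ?eq_lrshift ?eq_rshift.
Qed.

Lemma product_coloring_eq6 e :
  (product_coloring e == rshift t ord_max) = (block_pairs a e == 6).
Proof.
rewrite /product_coloring; have [/eqP->|_] := ifP; first by rewrite eq_rshift.
by have [_|_] := ifP; rewrite ?eqxx ?eq_lrshift.
Qed.

Definition color_deletions S i := [set v in S | product_coloring (S :\ v) == i].

Lemma color_deletions_disjoint S i j :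
  i != j -> #|color_deletions S i| + #|color_deletions S j| <= #|S|.
Proof.
move=> ij; rewrite -cardsUI [X in _ + X]eq_card0 => [|v].
  rewrite addn0; apply: subset_leq_card.
  by apply/subsetP=> v; rewrite !inE => /orP[] /andP[].
rewrite !inE; apply/negP=> /andP[/andP[_ /eqP ->] /andP[_ /eqP eq_ij]].
by rewrite eq_ij eqxx in ij.
Qed.

(** In a mixed 5-set one of the two new colors A and B occurs at least twice, so at
    most three deletions have an old color.  The bounds 3 and 4 are just
    below what a copy of a clique minus an edge, respectively a clique of order
    5, would need. *)
Lemma product_coloring_cases S : #|S| = 5 ->
  [\/ {in S &, injective a}, {in S &, forall u v, a u = a v} |
    [/\ exists i, 2 <= #|color_deletions S i|,
        forall i, #|color_deletions S (lshift 2 i)| <= 3 &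
        forall j, #|color_deletions S (rshift t j)| <= 4]].
Proof.
move=> card5; have [||[two le10 le6]] := five_set_cases a card5.
- by constructor 1.
- by constructor 2.
have D10 : color_deletions S (rshift t ord0) = deletions a S 10.
  by apply/setP=> v; rewrite !inE product_coloring_eq10.
have D6 : color_deletions S (rshift t ord_max) = deletions a S 6.
  by apply/setP=> v; rewrite !inE product_coloring_eq6.
constructor 3; split=> [|i|j].
- by case: two => le2; [exists (rshift t ord0); rewrite D10
                       | exists (rshift t ord_max); rewrite D6].
- have := @color_deletions_disjoint S (lshift 2 i) (rshift t ord0).
  have := @color_deletions_disjoint S (lshift 2 i) (rshift t ord_max).
  by rewrite !eq_lrshift D10 D6 => /(_ isT) + /(_ isT); lia.
- have /orP[/eqP->|/eqP->] : (j == ord0) || (j == ord_max) by case: j => -[|[]].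
    by rewrite D10.
  by rewrite D6.
Qed.

(** A transversal 5-set inherits a repetition from k through [a], one inside a
    block through [b], and a mixed one has its own. *)
Lemma product_coloring_repeats :
  (forall S : {set 'I_n}, #|S| = 5 ->
     exists v w, [/\ v \in S, w \in S, v != w & k (S :\ v) = k (S :\ w)]) ->
  forall S, #|S| = 5 -> exists v w, [/\ v \in S, w \in S, v != w &
    product_coloring (S :\ v) = product_coloring (S :\ w)].
Proof.
move=> k_repeats S card5.
have lift_repeat (g : V -> 'I_n) : {in S &, injective g} ->
    (forall v, v \in S -> product_coloring (S :\ v) = lshift 2 (k (g @: (S :\ v)))) ->
    exists v w, [/\ v \in S, w \in S, v != w &
      product_coloring (S :\ v) = product_coloring (S :\ w)].
  move=> g_inj colorE; have [|_ [_ [/imsetP[v vS ->] /imsetP[w wS ->] vw eq_k]]] :=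
    k_repeats (g @: S); first by rewrite card_in_imset.
  exists v, w; split=> //; first by apply: contraNneq vw => ->.
  by rewrite !colorE // !imset_setD1 // eq_k.
have card4 v : v \in S -> #|S :\ v| = 4.
  by move=> vS; move: card5; rewrite (cardsD1 v) vS => -[].
have sub v u : u \in S :\ v -> u \in S by rewrite inE => /andP[].
have [a_inj|a_const|[[i two] _ _]] := product_coloring_cases card5.
- apply: (lift_repeat a) => // v vS; apply: product_coloring_transversal.
    exact: card4.
  by move=> x y /sub xS /sub yS; apply: a_inj.
- apply: (lift_repeat b) => [x y xS yS|v vS].
    exact/ab_inj/a_const.
  apply: product_coloring_block; first exact: card4.
  by move=> x y /sub xS /sub yS; apply: a_const.
- have /card_gt1P[v [w [vD wD vw]]] := two; exists v, w; move: vD wD.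
  by rewrite !inE => /andP[-> /eqP ->] /andP[-> /eqP ->].
Qed.

Lemma card_color_deletions (G : hypergraph 4) (f : G -> V) i (X : {set G}) :
  injective f ->
  (forall e : {set G}, e \in edges G -> product_coloring (f @: e) = i) ->
  #|[set v in X | X :\ v \in edges G]| <= #|color_deletions (f @: X) i|.
Proof.
move=> f_inj f_mono; rewrite -(card_imset _ f_inj); apply: subset_leq_card.
apply/subsetP=> _ /imsetP[v + ->]; rewrite !inE => /andP[vX vE].
rewrite imset_f //= -imset_setD1 ?f_mono //; exact: in2W.
Qed.

(** No 5-set of the copy is mixed.  Hence if two of its vertices share a block, any
    third vertex, completed with these two to a 5-set, lies in the same block. *)
Lemma product_coloring_copy (G : hypergraph 4) (f : G -> V) i :
  4 < horder G -> at_most_one_nonedge G -> injective f ->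
  (forall e : {set G}, e \in edges G -> product_coloring (f @: e) = lshift 2 i) ->
  exists2 g : G -> 'I_n, injective g &
    forall e : {set G}, e \in edges G -> k (g @: e) = i.
Proof.
move=> orderG nonedge f_inj f_mono.
have [af_inj|] := boolP (injectiveb (a \o f)).
  move/injectiveP: af_inj => af_inj; exists (a \o f) => // e eE.
  apply: (@lshift_inj _ 2); rewrite imset_comp -product_coloring_transversal ?f_mono //.
    by rewrite card_imset // (edges_uniform eE).
  by move=> _ _ /imsetP[x _ ->] /imsetP[y _ ->] /af_inj ->.
case/injectivePn=> x [y xy a_xy].
have a_const z : a (f z) = a (f x).
  have [|X XE card5] := @superset_card G [set x; y; z] 5.
    rewrite orderG andbT (leq_trans _ (isT : 3 <= 5)) //.
    by rewrite -setUA cardsU1 cards2; case: (_ \notin _); case: (_ != _).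
  have fX u : u \in [set x; y; z] -> f u \in f @: X.
    by move=> uE; rewrite imset_f // (subsetP XE).
  have xX : f x \in f @: X by rewrite fX // !inE eqxx.
  have yX : f y \in f @: X by rewrite fX // !inE eqxx orbT.
  have zX : f z \in f @: X by rewrite fX // !inE eqxx orbT.
  have cardfX : #|f @: X| = 5 by rewrite card_imset.
  have [a_inj|a_const|[_ /(_ i) le3 _]] := product_coloring_cases cardfX.
  - by case/eqP: xy; apply/f_inj/a_inj.
  - exact: a_const.
  - have := card_deletion_edges nonedge card5.
    by have := card_color_deletions X f_inj f_mono; lia.
exists (b \o f) => [u v eq_b|e eE].
  by apply/f_inj/ab_inj => //; rewrite !a_const.
apply: (@lshift_inj _ 2); rewrite imset_comp -product_coloring_block ?f_mono //.
  by rewrite card_imset // (edges_uniform eE).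
by move=> _ _ /imsetP[u _ ->] /imsetP[v _ ->]; rewrite !a_const.
Qed.

(** A mixed 5-set has at most four deletions in a given new color, while any other
    5-set has all of them in old colors. *)
Lemma product_coloring_no_K5 (f : complete 4 5 -> V) j :
  injective f ->
  ~ forall e : {set complete 4 5}, e \in edges (complete 4 5) ->
      product_coloring (f @: e) = rshift t j.
Proof.
move=> f_inj f_mono.
have del_edges v : [set: 'I_5] :\ v \in edges (complete 4 5).
  rewrite inE; have := cardsD1 v [set: 'I_5].
  by rewrite cardsT card_ord in_setT => -[/esym/eqP].
have cardS : #|f @: setT| = 5 by rewrite card_imset // cardsT card_ord.
have sub v u : u \in f @: ([set: 'I_5] :\ v) -> u \in f @: setT.
  by apply/subsetP/imsetS/subsetT.
have card4 v : #|f @: ([set: 'I_5] :\ v)| = 4.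
  by rewrite card_imset // (edges_uniform (del_edges v)).
have [a_inj|a_const|[_ _ /(_ j)]] := product_coloring_cases cardS.
- have /eqP := f_mono _ (del_edges ord0).
  rewrite product_coloring_transversal ?eq_lrshift //.
  by move=> x y /sub xS /sub yS; apply: a_inj.
- have /eqP := f_mono _ (del_edges ord0).
  rewrite product_coloring_block ?eq_lrshift //.
  by move=> x y /sub xS /sub yS; apply: a_const.
- apply/negP; rewrite -ltnNge.
  apply: leq_trans (card_color_deletions setT f_inj f_mono).
  rewrite (_ : [set v in _ | _] = setT) ?cardsT ?card_ord //.
  by apply/setP=> v; rewrite [LHS]inE del_edges !inE.
Qed.

End ProductColoring.

(** * The lower bound *)

Lemma gallai_arrowN r t (Hs : 'I_t -> hypergraph r) p (i0 : 'I_t) :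
  ~~ gallai_arrow Hs p -> exists k : {set 'I_p} -> 'I_t,
    (forall S : {set 'I_p}, #|S| = r.+1 ->
       exists v w, [/\ v \in S, w \in S, v != w & k (S :\ v) = k (S :\ w)]) /\
    forall i, ~ exists2 f : Hs i -> 'I_p, injective f &
                  forall e : {set Hs i}, e \in edges (Hs i) -> k (f @: e) = i.
Proof.
case/forallPn=> c; rewrite negb_imply => /andP[c_gallai /existsPn no_copy].
pose k (e : {set complete r p}) : 'I_t := if insub e is Some e' then c e' else i0.
have kE e : c e = k (val e) by rewrite /k valK.
exists k; split; first exact/(gallaiP kE).
by move=> i /(has_mono_copyP kE); apply/negP.
Qed.

(** This makes the Gallai-Ramsey number positive, so that the truncated subtraction of
    1 from it is a genuine predecessor, at which the arrow fails. *)
Lemma gallai_arrow0 r t (Hs : 'I_t -> hypergraph r) (i0 : 'I_t) :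
  (forall i, 0 < horder (Hs i)) -> ~~ gallai_arrow Hs 0.
Proof.
move=> Hs_gt0; pose c : coloring (complete r 0) t := [ffun=> i0].
have cE e : c e = (fun=> i0) (val e) by rewrite ffunE.
apply/forallPn; exists c; rewrite negb_imply; apply/andP; split.
  by apply/(gallaiP cE) => S; have := max_card (mem S); rewrite card_ord => /[swap] ->.
apply/existsPn=> i; apply/negP=> /(has_mono_copyP cE)[f _ _].
by have /card_gt0P[x _] := Hs_gt0 i; case: (f x).
Qed.

Theorem theorem9 (t : nat) (Hs : 'I_t -> hypergraph 4)
    (t_ge1 : 1 <= t)
    (Hs_order : forall i : 'I_t, 4 < horder (Hs i))
    (Hs_shape : forall i : 'I_t,
       is_complete (Hs i) \/ is_complete_minus_edge (Hs i)) :
  gr (cat_family Hs (fun _ : 'I_2 => complete 4 5))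
    >= (gr Hs - 1) ^ 2 + 1.
Proof.
pose i0 := Ordinal t_ge1.
have nonedge i : at_most_one_nonedge (Hs i).
  case: (Hs_shape i); first exact: is_complete_nonedge.
  exact: is_complete_minus_edge_nonedge.
rewrite /gr; case: ex_minnP => m arrow_m min_m; case: ex_minnP => p arrow_p _.
have m_gt0 : 0 < m.
  rewrite lt0n; apply: contraTneq arrow_m => ->.
  by apply: gallai_arrow0 => // i; apply: leq_trans (Hs_order i).
rewrite subn1 addn1; set n := m.-1; rewrite ltnNge; apply/negP=> le_pn.
have not_arrow : ~~ gallai_arrow Hs n.
  by apply/negP=> /min_m; rewrite /n -ltnS prednK // ltnn.
have [k [k_repeats k_no_copy]] := gallai_arrowN i0 not_arrow.
have le_card : #|'I_p| <= #|{: 'I_n * 'I_n}|.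
  by rewrite card_prod !card_ord mulnn.
pose ab (x : 'I_p) : 'I_n * 'I_n := enum_val (widen_ord le_card (enum_rank x)).
have ab_inj : injective ab.
  by move=> x y /enum_val_inj/(congr1 val)/= /val_inj/enum_rank_inj.
pose a x := (ab x).1; pose b x := (ab x).2.
have ab_inj' u v : a u = a v -> b u = b v -> u = v.
  rewrite /a /b => eq_a eq_b; apply: ab_inj.
  by rewrite [LHS]surjective_pairing eq_a eq_b -surjective_pairing.
pose K := product_coloring k i0 a b.
pose c : coloring (complete 4 p) (t + 2) := [ffun e => K (val e)].
have cE e : c e = K (val e) by rewrite ffunE.
suff : ~~ gallai_arrow (cat_family Hs (fun _ : 'I_2 => complete 4 5)) p.
  by rewrite arrow_p.
apply/forallPn; exists c; rewrite negb_imply; apply/andP; split.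
  apply/(gallaiP cE); exact: product_coloring_repeats.
apply/existsPn=> i; apply/negP=> /(has_mono_copyP cE).
rewrite /cat_family; case: split_ordP => j -> [f f_inj f_mono].
  by apply: (k_no_copy j); apply: (product_coloring_copy _ _ _ f_inj f_mono).
exact: (product_coloring_no_K5 f_inj f_mono).
Qed.
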